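(* Suppose that $\varepsilon=0$ and $\Sigma_{\mathrm{pk}}\subseteq\Sigma_{\mathrm{cont}}$. Let $T\ge n+1$ and $u_{[0,T-1]}\in\mathbb{R}^{mT}$. If $$\operatorname{rank} M_{A,B}\,D_A\,\mathcal{H}_{n+1}(u_{[0,T-1]}) = n+m$$ for all $(A,B)\in\Sigma_{\mathrm{pk}}$, then the input $u_{[0,T-1]}$ is $\Sigma_{\mathrm{pk}}$-universal for identification.
   Context: Let $n,m\in\mathbb{N}$, $\varepsilon\ge 0$, and $\Sigma=\mathbb{R}^{n\times n}\times\mathbb{R}^{n\times m}$. $\Sigma_{\mathrm{cont}}\subseteq\Sigma$ is the set of controllable pairs. A signal $u(0),\dots,u(T-1)\in\mathbb{R}^m$ is identified with the stacked vector $u_{[0,T-1]}\in\mathbb{R}^{mT}$; similarly for $x_{[0,T]}$. For $T\in\mathbb{N}$ and $(A,B)\in\Sigma$, $\mathfrak{B}_T(A,B)$ is the set of all pairs $(u_{[0,T-1]},x_{[0,T]})$, with $u(t)\in\mathbb{R}^m$, $x(t)\in\mathbb{R}^n$, for which there exist $w(0),\dots,w(T-1)\in\mathbb{R}^n$ with $\|w(t)\|\le\varepsilon$ (Euclidean norm) and $x(t+1)=Ax(t)+Bu(t)+w(t)$ for $t=0,\dots,T-1$. $\mathfrak{B}(A,B,u_{[0,T-1]})$ is the set of those elements of $\mathfrak{B}_T(A,B)$ whose input part equals the given $u_{[0,T-1]}$ (the initial state is free). For a dataset $\mathcal{D}$, $\Sigma_{\mathcal{D}}=\{(A,B)\in\Sigma\mid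 \mathcal{D}\in\mathfrak{B}_T(A,B)\}$. $\Sigma_{\mathrm{pk}}\subseteq\Sigma$ is the prior knowledge set (it contains the unknown true system, hence is nonempty). A dataset $\mathcal{D}\in\mathfrak{B}_T(A,B)$ with $(A,B)\in\Sigma_{\mathrm{pk}}$ is $\Sigma_{\mathrm{pk}}$-informative for identification if $\Sigma_{\mathcal{D}}\cap\Sigma_{\mathrm{pk}}$ is a singleton. An input $u_{[0,T-1]}$ is $\Sigma_{\mathrm{pk}}$-universal for identification if every $\mathcal{D}\in\bigcup_{(A,B)\in\Sigma_{\mathrm{pk}}}\mathfrak{B}(A,B,u_{[0,T-1]})$ is $\Sigma_{\mathrm{pk}}$-informative for identification. For $1\le k\le T$, the Hankel matrix $\mathcal{H}_k(u_{[0,T-1]})$ of depth $k$ is the $mk\times(T-k+1)$ matrix whose $j$-th column ($j=0,\dots,T-k$) is the stacked vector of $u(j),\dots,u(j+k-1)$. For $(A,B)\in\Sigma$, $$M_{A,B}=\begin{bmatrix}0 & B & AB & \cdots & A^{n-1}B\\ I_m & 0 & 0 & \cdots & 0\end{bmatrix}\in\mathbb{R}^{(n+m)\times m(n+1)},\qquad D_A=\begin{bmatrix} d_0 & \cdots & d_{n-1} & d_n\\ d_1 & \cdots & d_n & 0\\ \vdots & & \vdots & \vdots\\ d_n & \cdots & 0 & 0\end{bmatrix}\otimes I_m,$$ where $d_0,\dots,d_n\in\mathbb{R}$, $d_n=1$, are the coefficients of the characteristic polynomial $\sum_{i=0}^n d_i z^i$ of $A$ (the $(i,j)$ entry, $i,j=0,\dots,n$,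 of the left factor is $d_{i+j}$ if $i+j\le n$ and $0$ otherwise). *)

(* Defs.v *)
From mathcomp Require Import all_boot all_order all_algebra.
From mathcomp Require Import all_classical reals.
From mathcomp Require Export mxtens.

Set Implicit Arguments.
Unset Strict Implicit.
Unset Printing Implicit Defensive.

Import Order.TTheory GRing.Theory Num.Theory.
Local Open Scope classical_set_scope.
Local Open Scope ring_scope.

Definition system (R : realType) (n m : nat) : Type :=
  ('M[R]_n * 'M[R]_(n, m))%type.

(* Any state can be steered to any other state in finite time. *)
Definition controllable (R : realType) (n m : nat) (S : system R n m) : Prop :=
  forall x0 x1 : 'cV[R]_n,
  exists (N : nat) (u : nat -> 'cV[R]_m) (x : nat -> 'cV[R]_n),
    [/\ x 0%N = x0, x N = x1 &
        forall t, (t < N)%N -> x t.+1 = S.1 *m x t + S.2 *m u t].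

Definition Sigma_cont (R : realType) (n m : nat) : set (system R n m) :=
  [set S | controllable S].

(* The norm that the analysis library puts on matrices is the sup norm. *)
Definition euclidean_norm (R : realType) (n : nat) (v : 'cV[R]_n) : R :=
  Num.sqrt (\sum_(i < n) v i 0 ^+ 2).

(* The inputs u(0), ..., u(T-1) and the states x(0), ..., x(T). *)
Definition dataset (R : realType) (n m T : nat) : Type :=
  (('I_T -> 'cV[R]_m) * ('I_T.+1 -> 'cV[R]_n))%type.

(* The ordinals [widen_ord (leqnSn T) t] and [lift ord0 t] are t and t + 1. *)
Definition behavior (R : realType) (n m : nat) (eps : R) (T : nat)
    (S : system R n m) : set (dataset R n m T) :=
  [set D | exists w : 'I_T -> 'cV[R]_n,
     (forall t, euclidean_norm (w t) <= eps) /\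
     (forall t, D.2 (lift ord0 t) =
        S.1 *m D.2 (widen_ord (leqnSn T) t) + S.2 *m D.1 t + w t)].

Definition behavior_input (R : realType) (n m : nat) (eps : R) (T : nat)
    (S : system R n m) (u : 'I_T -> 'cV[R]_m) : set (dataset R n m T) :=
  [set D | behavior eps S D /\ D.1 = u].

Definition Sigma_data (R : realType) (n m : nat) (eps : R) (T : nat)
    (D : dataset R n m T) : set (system R n m) :=
  [set S | behavior eps S D].

Definition informative (R : realType) (n m : nat) (eps : R) (T : nat)
    (Sigma_pk : set (system R n m)) (D : dataset R n m T) : Prop :=
  exists S, Sigma_data eps D `&` Sigma_pk = [set S].

Definition universal (R : realType) (n m : nat) (eps : R) (T : nat)
    (Sigma_pk : set (system R n m)) (u : 'I_T -> 'cV[R]_m) : Prop :=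
  forall D : dataset R n m T,
    (\bigcup_(S in Sigma_pk) behavior_input eps S u) D ->
    informative eps Sigma_pk D.

Fact hankel_index_subproof (k T : nat) (hkT : (k <= T)%N)
  (j : 'I_(T - k).+1) (i : 'I_k) : (j + i < T)%N.
Proof.
have le_jkT : (j + k <= T)%N by rewrite addnC -leq_subRL // -ltnS ltn_ord.
by apply: leq_trans le_jkT; rewrite ltn_add2l.
Qed.

(* Row [mxtens_index (i, a)], of value i * m + a, is row a of the i-th block. *)
Definition hankel (R : realType) (m k T : nat) (hkT : (k <= T)%N)
    (u : 'I_T -> 'cV[R]_m) : 'M[R]_(k * m, (T - k).+1) :=
  \matrix_(r, j)
    let: (i, a) := mxtens_unindex r in
    u (Ordinal (hankel_index_subproof hkT j i)) a 0.

(* The row [F 0, ..., F (k - 1)] of k blocks with m columns each. *)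
Definition block_row (R : realType) (p m k : nat) (F : 'I_k -> 'M[R]_(p, m)) :
    'M[R]_(p, k * m) :=
  \matrix_(r, c) let: (j, b) := mxtens_unindex c in F j r b.

Definition M_mx (R : realType) (n m : nat) (S : system R n m) :
    'M[R]_(n + m, n.+1 * m) :=
  col_mx
    (block_row (fun j : 'I_n.+1 =>
       if val j is i.+1 then S.1 ^+ i *m S.2 else 0))
    (block_row (fun j : 'I_n.+1 => if val j is 0%N then 1%:M else 0)).

(* Coefficients of index above the degree n of [char_poly A] are 0. *)
Definition D_mx (R : realType) (n m : nat) (A : 'M[R]_n) :
    'M[R]_(n.+1 * m, n.+1 * m) :=
  (\matrix_(i < n.+1, j < n.+1) (char_poly A)`_(i + j)) *t (1%:M : 'M[R]_m).

(* Main.v *)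
Require Import Defs.
From mathcomp Require Import all_boot all_order all_algebra.
From mathcomp Require Import all_classical reals.

(** Fix a dataset generated by a system (A, B) of the prior knowledge set, with
    d the characteristic polynomial of A.  Along a noise-free trajectory
      x(l) = A^l x(0) + sum_(i < l) A^i B u(l - 1 - i),
    so weighting by the coefficients d_l and using Cayley-Hamilton to kill the
    contribution of the initial state leaves
      sum_l d_l x(l) = sum_(i < n) A^i B sum_l d_(i+1+l) u(l).
    The right-hand side is a column of the upper block of M_(A,B) D_A H, and
    the lower block contributes sum_l d_l u(l).  By time invariance, column j of
    M_(A,B) D_A H is therefore sum_l d_l [x(j+l); u(j+l)]: it lies in the span
    of the state-input samples ([col_rank_matrix]).

    If a second system is consistent with the same data, the difference
    [A' - A, B' - B] annihilates every sample, hence every column of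
    M_(A,B) D_A H.  That matrix has full row rank, so the difference is 0 and
    the two systems coincide. *)

Set Implicit Arguments.
Unset Strict Implicit.
Unset Printing Implicit Defensive.

Import Order.TTheory GRing.Theory Num.Theory.
Local Open Scope classical_set_scope.
Local Open Scope ring_scope.

(** Cayley-Hamilton as an explicit sum.  Size 0 is treated apart, because the
    evaluation of polynomials at a matrix presupposes a nontrivial ring. *)
Lemma char_poly_sum_eq0 (R : comNzRingType) (n : nat) (A : 'M[R]_n) :
  \sum_(l < n.+1) (char_poly A)`_l *: A ^+ l = 0.
Proof.
case: n A => [|n] A; first by rewrite [LHS]flatmx0 [RHS]flatmx0.
rewrite -[RHS](Cayley_Hamilton A) /horner_mx /horner_morph.
rewrite (@horner_coef_wide _ n.+2); last first.
  by rewrite (leq_trans (size_poly _ _)) // size_char_poly.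
apply: eq_bigr => l _; rewrite coef_map /=.
by rewrite -[_ * _]/(_ *m _) mul_scalar_mx.
Qed.

Section Trajectories.

Variables (R : comNzRingType) (n m : nat).
Variables (A : 'M[R]_n) (B : 'M[R]_(n, m)).
Variables (x : nat -> 'cV[R]_n) (u : nat -> 'cV[R]_m).

Lemma state_expansion (l : nat) :
    (forall t, (t < l)%N -> x t.+1 = A *m x t + B *m u t) ->
  x l = A ^+ l *m x 0 + \sum_(i < l) A ^+ i *m B *m u (l - i.+1)%N.
Proof.
elim: l => [|l IHl] xE.
  by rewrite big_ord0 addr0 expr0 -[1]/(1%:M) mul1mx.
rewrite xE // IHl => [|t lt_tl]; last exact/xE/ltnW.
rewrite mulmxDr big_ord_recl expr0 -[1]/(1%:M) mul1mx subn1 /= exprS.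
rewrite -[A * _]/(A *m _) mulmxA -addrA; congr (_ + _); rewrite addrC.
congr (_ + _); rewrite mulmx_sumr; apply: eq_bigr => i _.
by rewrite /bump add1n subSS exprS -[A * _]/(A *m _) !mulmxA.
Qed.

(** The double sum over i < l <= N is reorganised by the power A^i carried by
    each input, which turns the weights into a Hankel pattern d_(i+1+l). *)
Lemma weighted_state_sum (N : nat) (d : nat -> R) :
    (forall k, (N < k)%N -> d k = 0) ->
    (forall t, (t < N)%N -> x t.+1 = A *m x t + B *m u t) ->
  \sum_(l < N.+1) d l *: x l =
  (\sum_(l < N.+1) d l *: A ^+ l) *m x 0 +
  \sum_(i < N) A ^+ i *m B *m \sum_(l < N.+1) d (i.+1 + l)%N *: u l.
Proof.
move=> d0 xE.
transitivity (\sum_(l < N.+1) (d l *: A ^+ l *m x 0 +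
    \sum_(i < N | (i < l)%N) d l *: (A ^+ i *m B *m u (l - i.+1)%N))).
  apply: eq_bigr => l _; rewrite {1}state_expansion => [|t lt_tl]; last first.
    by apply: xE; apply: leq_trans lt_tl _; rewrite -ltnS.
  rewrite scalerDr scalemxAl; congr (_ + _).
  have leN : (l <= N)%N by rewrite -ltnS.
  rewrite (big_ord_widen N (fun i => A ^+ i *m B *m u (l - i.+1)%N)) //.
  by rewrite scaler_sumr.
rewrite big_split mulmx_suml /=; congr (_ + _).
rewrite (exchange_big_dep predT) //=; apply: eq_bigr => i _.
rewrite mulmx_sumr.
pose G l := d l *: (A ^+ i *m B *m u (l - i.+1)%N).
transitivity (\sum_(i.+1 <= l < N.+1) G l).
  by rewrite big_geq_mkord big_mkcond [RHS]big_mkcond.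
rewrite -[X in \sum_(X <= _ < _) _]add0n big_addn big_mkord.
rewrite (big_ord_widen N.+1 (fun l => G (l + i.+1)%N)) ?leq_subr //.
rewrite big_mkcond; apply: eq_bigr => l _; rewrite /G addnK addnC scalemxAr.
by case: ifPn => //; rewrite -leqNgt leq_subLR => /d0 ->; rewrite scale0r mulmx0.
Qed.

End Trajectories.

Section Blocks.

Variables (R : realType) (m k p : nat).

Definition row_block (V : 'M[R]_(k * m, p)) (i : 'I_k) : 'M[R]_(m, p) :=
  \matrix_(a, j) V (mxtens_index (i, a)) j.

Lemma sum_mxtens (F : 'I_(k * m) -> R) :
  \sum_r F r = \sum_(i < k) \sum_(a < m) F (mxtens_index (i, a)).
Proof.
rewrite pair_big /= (reindex (@mxtens_index k m)) /=; last first.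
  by exists (@mxtens_unindex k m) => i _; rewrite (mxtens_indexK, mxtens_unindexK).
by apply: eq_bigr => -[].
Qed.

Lemma mul_block_row (q : nat) (F : 'I_k -> 'M[R]_(q, m)) (V : 'M[R]_(k * m, p)) :
  block_row F *m V = \sum_i F i *m row_block V i.
Proof.
apply/matrixP => r j; rewrite summxE mxE sum_mxtens; apply: eq_bigr => i _.
rewrite mxE; apply: eq_bigr => a _; rewrite [block_row _ _ _]mxE [row_block _ _ _ _]mxE.
by rewrite mxtens_indexK.
Qed.

Lemma row_block_tens1 (C : 'M[R]_k) (V : 'M[R]_(k * m, p)) (i : 'I_k) :
  row_block ((C *t (1%:M : 'M_m)) *m V) i = \sum_l C i l *: row_block V l.
Proof.
apply/matrixP => a j; rewrite mxE mxE summxE sum_mxtens; apply: eq_bigr => l _.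
rewrite (bigD1 a) //= big1 => [|b neq_ba].
  by rewrite addr0 tensmxE mxE eqxx mulr1 !mxE.
by rewrite tensmxE [1%:M _ _]mxE eq_sym (negPf neq_ba) mulr0 mul0r.
Qed.

End Blocks.

(** The crux: Cayley-Hamilton turns an expression in A, B and u alone into a
    combination of measured samples with weights d_l. *)
Lemma col_rank_matrix (R : realType) (n m T : nat) (hT : (n.+1 <= T)%N)
    (S : system R n m) (x : nat -> 'cV[R]_n) (u : nat -> 'cV[R]_m)
    (j : 'I_(T - n.+1).+1) :
    (forall t, (t < T)%N -> x t.+1 = S.1 *m x t + S.2 *m u t) ->
  col j (M_mx S *m D_mx m S.1 *m hankel hT (fun t => u t)) =
  \sum_(l < n.+1) (char_poly S.1)`_l *: col_mx (x (j + l)%N) (u (j + l)%N).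
Proof.
case: S => A B /= xE.
have lt_jnT : (j + n < T)%N.
  by rewrite -addnS addnC -leq_subRL // -ltnS ltn_ord.
have hankelE i : col j (row_block (D_mx m A *m hankel hT (fun t => u t)) i) =
    \sum_(l < n.+1) (char_poly A)`_(i + l) *: u (j + l)%N.
  rewrite row_block_tens1 !linear_sum /=; apply: eq_bigr => l _.
  rewrite linearZ /= mxE; congr (_ *: _); apply/colP => a.
  by rewrite !mxE mxtens_indexK.
have colM q (C : 'M[R]_(q, m)) i :
    col j (C *m row_block (D_mx m A *m hankel hT (fun t => u t)) i) =
    C *m \sum_(l < n.+1) (char_poly A)`_(i + l) *: u (j + l)%N.
  by rewrite -hankelE !colE mulmxA.
have time_invariant t : (t < n)%N ->
    x (j + t.+1)%N = A *m x (j + t)%N + B *m u (j + t)%N.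
  move=> lt_tn; rewrite addnS xE //.
  by apply: ltn_trans lt_jnT; rewrite ltn_add2l.
(* The coefficients past the degree vanish, so every shifted weight d_(i+l) can
   be summed over the full window. *)
have d0 k : (n < k)%N -> (char_poly A)`_k = 0.
  by move=> lt_nk; rewrite nth_default // size_char_poly.
transitivity (col_mx (\sum_(l < n.+1) (char_poly A)`_l *: x (j + l)%N)
                     (\sum_(l < n.+1) (char_poly A)`_l *: u (j + l)%N)); last first.
  apply/colP => r; rewrite -[r]fintype.splitK summxE; case: (fintype.split r) => a /=.
    by rewrite col_mxEu summxE; apply: eq_bigr => l _; rewrite mxE [RHS]mxE col_mxEu.
  by rewrite col_mxEd summxE; apply: eq_bigr => l _; rewrite mxE [RHS]mxE col_mxEd.
rewrite (weighted_state_sum d0 time_invariant) char_poly_sum_eq0 mul0mx add0r.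
rewrite -mulmxA mul_col_mx col_col_mx !mul_block_row !linear_sum /=.
congr col_mx.
  rewrite big_ord_recl colM mul0mx add0r.
  by apply: eq_bigr => i _; rewrite colM.
rewrite big_ord_recl colM mul1mx [X in _ + X]big1 ?addr0 // => i _.
by rewrite colM mul0mx.
Qed.

Lemma euclidean_norm_le0 (R : realType) (n : nat) (v : 'cV[R]_n) :
  euclidean_norm v <= 0 -> v = 0.
Proof.
rewrite /euclidean_norm => v_le0.
have sum_ge0 : 0 <= \sum_(i < n) v i 0 ^+ 2 by apply: sumr_ge0 => i _; exact: sqr_ge0.
have: Num.sqrt (\sum_(i < n) v i 0 ^+ 2) == 0 by rewrite eq_le v_le0 sqrtr_ge0.
rewrite sqrtr_eq0 => sum_le0; apply/colP => i; rewrite mxE.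
have /eqP : \sum_(i < n) v i 0 ^+ 2 = 0 by apply/eqP; rewrite eq_le sum_le0.
rewrite psumr_eq0 => [|k _]; last exact: sqr_ge0.
by move=> /allP /(_ i); rewrite mem_index_enum sqrf_eq0 => /(_ isT) /eqP.
Qed.

Lemma behavior0E (R : realType) (n m T : nat) (S : system R n m)
    (D : dataset R n m T) :
  behavior 0 S D -> forall t,
    D.2 (lift ord0 t) = S.1 *m D.2 (widen_ord (leqnSn T) t) + S.2 *m D.1 t.
Proof.
by move=> [w [w0 DE]] t; rewrite DE (euclidean_norm_le0 (w0 t)) addr0.
Qed.

Theorem theorem9 (R : realType) (n m : nat) (eps : R) (heps : eps = 0)
    (Sigma_pk : set (system R n m)) (hpk0 : Sigma_pk !=set0)
    (hpk : Sigma_pk `<=` @Sigma_cont R n m)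
    (T : nat) (hT : (n.+1 <= T)%N) (u : 'I_T -> 'cV[R]_m)
    (hrank : forall S : system R n m, Sigma_pk S ->
       \rank (M_mx S *m D_mx m S.1 *m hankel hT u) = (n + m)%N) :
  universal eps Sigma_pk u.
Proof.
subst eps => D [S pkS [behS Du]]; subst u; exists S.
apply/seteqP; split=> [S' [behS' _]|_ ->]; last by split.
(* Signals on all of nat, so that time shifts need no ordinal arithmetic; the
   values beyond the data horizon are arbitrary. *)
pose t0 : 'I_T := Ordinal (leq_trans (ltn0Sn n) hT).
pose x k := D.2 (inord k); pose u k := D.1 (insubd t0 k).
have uE : D.1 = (fun t => u t) by apply/funext => t; rewrite /u valKd.
have stepE (S0 : system R n m) : behavior 0 S0 D ->
    forall t, (t < T)%N -> x t.+1 = S0.1 *m x t + S0.2 *m u t.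
  move=> /behavior0E DE t lt_tT; have := DE (Ordinal lt_tT); rewrite /x /u.
  have -> : lift ord0 (Ordinal lt_tT) = inord t.+1.
    by apply: val_inj; rewrite /= inordK.
  have -> : widen_ord (leqnSn T) (Ordinal lt_tT) = inord t.
    by apply: val_inj; rewrite /= inordK // ltnW.
  by have -> : insubd t0 t = Ordinal lt_tT by apply: val_inj; rewrite val_insubd lt_tT.
have xS := stepE S behS; have xS' := stepE S' behS'.
move: (hrank S pkS); rewrite uE => rankE.
set X := M_mx S *m _ *m _ in rankE.
have freeX : row_free X by rewrite /row_free rankE.
(* Both systems produce the same successor states, so their difference
   annihilates every state-input sample. *)
pose Delta := row_mx (S'.1 - S.1) (S'.2 - S.2).
have Delta_sample t : (t < T)%N -> Delta *m col_mx (x t) (u t) = 0.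
  move=> lt_tT; rewrite mul_row_col !mulmxBl addrACA -opprD.
  by rewrite -xS // -xS' // subrr.
have DeltaX : Delta *m X = 0.
  apply/matrixP => i j; rewrite [RHS]mxE.
  transitivity (col j (Delta *m X) i 0); first by rewrite [RHS]mxE.
  rewrite colE -mulmxA -colE (col_rank_matrix hT j xS) mulmx_sumr.
  rewrite big1 => [|l _]; first by rewrite mxE.
  by rewrite -scalemxAr Delta_sample ?scaler0 // hankel_index_subproof.
have : Delta = 0 by apply: (row_free_inj freeX); rewrite mul0mx.
rewrite -[0]row_mx0 => /eq_row_mx [/subr0_eq eqA /subr0_eq eqB].
by rewrite /= (surjective_pairing S') eqA eqB -surjective_pairing.
Qed.
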